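(* Let $0<q<1$, let $s\in\{0,\tfrac12,1,\tfrac32,\dots\}$, let $\ell\in\mathcal{J}_s$, and put $a=|s-\ell|$, $N=\min(2s,s+\ell)-|s-\ell|$. Let $S_1,S_2$ be the invertible $(N+1)\times(N+1)$ matrices and $P$ the $(N+1)\times(N+1)$ matrix defined in the context. Then $$S_1S_2S_1=m_q\,P,\qquad (S_1S_2S_1)^{-1}=m_{q^{-1}}\,P,$$ where $$m_q=q^{2N(3a+N+2)}\,\frac{(q^{-2(a+N)};q^2)_N}{(q^{4(a+1)};q^2)_N}$$ and $m_{q^{-1}}$ denotes the expression obtained from $m_q$ by replacing $q$ by $q^{-1}$ everywhere.
   Context: Throughout $0<q<1$. For $s\in\{0,\frac12,1,\frac32,\dots\}$, $\mathcal{J}_s=\{j_{\min},j_{\min}+1,\dots,3s\}$ with $j_{\min}=0$ if $s$ is an integer and $j_{\min}=\frac12$ if $s$ is a half-integer (not an integer). For $\ell\in\mathcal{J}_s$, $a=|s-\ell|$ and $N=\min(2s,s+\ell)-|s-\ell|$ are nonnegative integers. Notation. $\chi_j=q^{2j+1}+q^{-2j-1}$. $(z;p)_0=1$, $(z;p)_k=\prod_{i=1}^k(1-zp^{i-1})$, and $(z_1,\dots,z_r;p)_k=(z_1;p)_k\cdots(z_r;p)_k$. $\mathbb{I}_{N+1}$ is the identity matrix. Rows and columns of matrices are indexed by $0,1,\dots,N$. Matrices $X_1,X_2$. $X_1=\mathrm{diag}(\chi_a,\chi_{a+1},\dots,\chi_{a+N})$, and $X_2$ is the tridiagonal matrix with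 $(i,j)$ entry $\alpha_{i,j}$ for $|i-j|\le1$ and $0$ otherwise, where for $1\le j\le N$ $$\alpha_{j-1,j}=q^{-2a-1}\frac{(1-q^{2(j+a)})(1-q^{2(j+2a)})(1-q^{2(j-N-1)})(1-q^{2(j+3a+N+1)})}{(1-q^{2(2j+2a-1)})(1-q^{2(2j+2a)})},$$ $$\alpha_{j,j-1}=q^{2a+1}\frac{(1-q^{2(j+a)})(1-q^{2j})(1-q^{2(j+2a+N+1)})(1-q^{2(j-a-N-1)})}{(1-q^{2(2j+2a)})(1-q^{2(2j+2a+1)})},$$ with $\alpha_{0,-1}=\alpha_{N,N+1}=0$, and for $0\le j\le N$, $\alpha_{j,j}=\chi_a-(\alpha_{j,j+1}+\alpha_{j,j-1})$. (These matrices represent the intermediate Casimir elements $C_{12}$ and $C_{23}$ of $U_q(\mathfrak{sl}_2)$ in the irreducible representation, labelled by $\ell$, of the centralizer of the diagonal action of $U_q(\mathfrak{sl}_2)$ on the threefold tensor power of its spin-$s$ representation. Both have eigenvalues $\chi_{a},\dots,\chi_{a+N}$.) Matrices $S_1,S_2$. For $i=1,2$, $$S_i=\sum_{r=0}^N\gamma_r\prod_{\substack{k=0\\k\ne r}}^N\frac{X_i-\chi_{a+k}\mathbb{I}_{N+1}}{\chi_{a+r}-\chi_{a+k}},\qquad \gamma_r=(-1)^rq^{r(r+2a+1)}.$$ In particular $S_1=\mathrm{diag}(\gamma_0,\dots,\gamma_N)$. Matrix $P$. For $0\le i,j\le N$, $$P_{ij}=\beta_j^2\sum_{k=0}^{\min(i,j)}\frac{(q^{-2i},q^{2(2a+1+i)},q^{-2j},q^{2(2a+1+j)};q^2)_k}{(q^{2(a+1)},q^{-2N},q^{2(3a+N+2)};q^2)_k}\frac{q^{2k}}{(q^2;q^2)_k},$$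 $$\beta_j^2=q^{-2j(2a+1)}\frac{(q^{2a+3},-q^{2a+3},q^{2(2a+1)},q^{2(3a+N+2)},q^{-2N};q^2)_j}{(q^2,q^{2a+1},-q^{2a+1},q^{-2(a+N)},q^{2(2a+N+2)};q^2)_j}.$$ The sum in $P_{ij}$ is the terminating basic hypergeometric series ${}_4\phi_3$ (with base $q^2$ and argument $q^2$), i.e. the $q$-Racah polynomial $R_i(\mu(j);q^{2a},q^{2a},q^{2(3a+N+1)},q^{-2(a+N+1)}|q^2)$. The matrix $P$ is invertible and satisfies $X_2=PX_1P^{-1}$. *)

(* Defs.v *)
From HB Require Import structures.
From mathcomp Require Import all_boot all_order all_algebra.
From mathcomp Require Import zify ring lra.

Set Implicit Arguments.
Unset Strict Implicit.
Unset Printing Implicit Defensive.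

Import Order.TTheory GRing.Theory Num.Theory.
Local Open Scope ring_scope.

Definition is_spin (s : rat) : Prop := exists m : nat, s = m%:R / 2.

Definition j_min (s : rat) : rat := if s \is a Num.int then 0 else 1 / 2.

(* l belongs to {j_min, j_min + 1, ..., 3s} *)
Definition in_J (s l : rat) : Prop :=
  exists k : nat, l = j_min s + k%:R /\ l <= 3 * s.

(* The two spin parameters a and N are natural numbers, so that introducing
   them in nat through these equations loses nothing. *)
Lemma spin_params_exist (s l : rat) : is_spin s -> in_J s l ->
  exists a N : nat, a%:R = `|s - l| /\
    N%:R = Num.min (2 * s) (s + l) - `|s - l|.
Proof.
move=> [m ->] [k [-> hl]].
have [b hb] : exists b : nat, exists u : nat,
    m%:R / 2 = b%:R / 2 + u%:R :> rat /\ j_min (m%:R / 2) = b%:R / 2.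
  exists (odd m), m./2.
  have e : m%:R / 2 = (odd m)%:R / 2 + (m./2)%:R :> rat.
    by rewrite -{1}(odd_double_half m) -muln2 natrD natrM; field.
  split=> //; rewrite /j_min; case: ifPn => [hi|]; case: (odd m) e => e; rewrite ?mul0r //=.
  - suff : (2^-1 : rat) \is a Num.int by [].
    have -> : 2^-1 = m%:R / 2 - (m./2)%:R :> rat by rewrite e addrK mul1r.
    by rewrite rpredB ?rpred_nat.
  - by rewrite e mul0r add0r rpred_nat.
case: hb => u [es ej]; rewrite ej es in hl *.
have hk : (k <= b + 3 * u)%N.
  rewrite -(ler_nat rat) natrD natrM; lra.
have -> : b%:R / 2 + u%:R - (b%:R / 2 + k%:R) = u%:R - k%:R :> rat by ring.
case: (leqP k u) => h.
  exists (u - k)%N; rewrite natrB // ger0_norm ?subr_ge0 ?ler_nat //.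
  exists (b + k + k)%N; split=> //; rewrite min_r; first by rewrite !natrD; field.
  have : (k%:R <= u%:R :> rat) by rewrite ler_nat.
  lra.
exists (k - u)%N; rewrite natrB 1?ltnW // ler0_norm; last first.
  by rewrite subr_le0 ler_nat ltnW.
exists (b + 3 * u - k)%N; split; first by ring.
rewrite natrB // min_l; first by rewrite natrD natrM; field.
have : (u%:R <= k%:R :> rat) by rewrite ler_nat ltnW.
lra.
Qed.

Section Definitions.

Variable R : realFieldType.
Implicit Types q z p : R.

(* (z_1, ..., z_r; p)_k, the z_i being listed in zs *)
Definition qpoch (zs : seq R) p (k : nat) : R :=
  \prod_(z <- zs) \prod_(i < k) (1 - z * p ^+ i).

Definition chi q (j : nat) : R := q ^ (2 * j + 1)%:Z + q ^ (- 2 * j%:Z - 1).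

(* alpha_{j-1,j} for 1 <= j <= N *)
Definition alpha_up q (a N j : nat) : R :=
  q ^ (- 2 * a%:Z - 1) *
  ((1 - q ^ (2 * (j%:Z + a%:Z))) *
   (1 - q ^ (2 * (j%:Z + 2 * a%:Z))) *
   (1 - q ^ (2 * (j%:Z - N%:Z - 1))) *
   (1 - q ^ (2 * (j%:Z + 3 * a%:Z + N%:Z + 1)))) /
  ((1 - q ^ (2 * (2 * j%:Z + 2 * a%:Z - 1))) *
   (1 - q ^ (2 * (2 * j%:Z + 2 * a%:Z)))).

(* alpha_{j,j-1} for 1 <= j <= N *)
Definition alpha_down q (a N j : nat) : R :=
  q ^ (2 * a%:Z + 1) *
  ((1 - q ^ (2 * (j%:Z + a%:Z))) *
   (1 - q ^ (2 * j%:Z)) *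
   (1 - q ^ (2 * (j%:Z + 2 * a%:Z + N%:Z + 1))) *
   (1 - q ^ (2 * (j%:Z - a%:Z - N%:Z - 1)))) /
  ((1 - q ^ (2 * (2 * j%:Z + 2 * a%:Z))) *
   (1 - q ^ (2 * (2 * j%:Z + 2 * a%:Z + 1)))).

(* alpha_{i,i+1} and alpha_{i,i-1} for 0 <= i <= N, with the convention
   alpha_{N,N+1} = alpha_{0,-1} = 0 *)
Definition alpha_next q (a N i : nat) : R :=
  if (i < N)%N then alpha_up q a N i.+1 else 0.
Definition alpha_prev q (a N i : nat) : R :=
  if (0 < i)%N then alpha_down q a N i else 0.

Definition X1 q (a N : nat) : 'M[R]_N.+1 :=
  diag_mx (\row_(i < N.+1) chi q (a + i)).

Definition X2 q (a N : nat) : 'M[R]_N.+1 :=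
  \matrix_(i < N.+1, j < N.+1)
    if j == i.+1 :> nat then alpha_next q a N i
    else if i == j.+1 :> nat then alpha_prev q a N i
    else if i == j then chi q a - (alpha_next q a N i + alpha_prev q a N i)
    else 0.

Definition gamma q (a r : nat) : R := (-1) ^+ r * q ^+ (r * (r + 2 * a + 1)).

Definition S_of q (a N : nat) (X : 'M[R]_N.+1) : 'M[R]_N.+1 :=
  \sum_(r < N.+1) gamma q a r *:
    \prod_(k < N.+1 | k != r)
      ((chi q (a + r) - chi q (a + k))^-1 *: (X - (chi q (a + k))%:M)).

Definition S1 q (a N : nat) : 'M[R]_N.+1 := S_of q a (X1 q a N).
Definition S2 q (a N : nat) : 'M[R]_N.+1 := S_of q a (X2 q a N).

(* beta_j^2 *)
Definition beta2 q (a N j : nat) : R :=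
  q ^ (- 2 * j%:Z * (2 * a%:Z + 1)) *
  qpoch [:: q ^ (2 * a%:Z + 3); - q ^ (2 * a%:Z + 3); q ^ (2 * (2 * a%:Z + 1));
            q ^ (2 * (3 * a%:Z + N%:Z + 2)); q ^ (- 2 * N%:Z)] (q ^+ 2) j /
  qpoch [:: q ^+ 2; q ^ (2 * a%:Z + 1); - q ^ (2 * a%:Z + 1);
            q ^ (- 2 * (a%:Z + N%:Z)); q ^ (2 * (2 * a%:Z + N%:Z + 2))]
    (q ^+ 2) j.

(* the q-Racah polynomial R_i(mu(j)) as a terminating 4phi3 series *)
Definition qRacah q (a N i j : nat) : R :=
  \sum_(k < (minn i j).+1)
    qpoch [:: q ^ (- 2 * i%:Z); q ^ (2 * (2 * a%:Z + 1 + i%:Z));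
              q ^ (- 2 * j%:Z); q ^ (2 * (2 * a%:Z + 1 + j%:Z))] (q ^+ 2) k /
    qpoch [:: q ^ (2 * (a%:Z + 1)); q ^ (- 2 * N%:Z);
              q ^ (2 * (3 * a%:Z + N%:Z + 2))] (q ^+ 2) k *
    (q ^+ (2 * k) / qpoch [:: q ^+ 2] (q ^+ 2) k).

Definition P_mx q (a N : nat) : 'M[R]_N.+1 :=
  \matrix_(i < N.+1, j < N.+1) (beta2 q a N j * qRacah q a N i j).

Definition m_coef q (a N : nat) : R :=
  q ^ (2 * N%:Z * (3 * a%:Z + N%:Z + 2)) *
  qpoch [:: q ^ (- 2 * (a%:Z + N%:Z))] (q ^+ 2) N /
  qpoch [:: q ^ (4 * (a%:Z + 1))] (q ^+ 2) N.

End Definitions.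

(* Main.v *)
Require Import Defs.
From mathcomp Require Import all_boot all_order all_algebra.
From mathcomp Require Import zify ring.

Import Order.TTheory GRing.Theory Num.Theory.
Local Open Scope ring_scope.

(** Write [D] for [S1] and [P] for [P_mx]. The columns of [P] are eigenvectors of
    [X2], by the three-term recurrence of the q-Racah polynomials ([qRacah_rec]),
    so that [X2 P = P X1] and [S2 P = P D]. These polynomials are symmetric in degree and
    grid point, and [beta2] is reversible for [X2]; transposing the recurrence
    therefore gives the dual relation [X1 P = P X2] ([X1_P_mx]).

    The matrices [X1] and [X2] satisfy an Askey-Wilson relation which says that
    conjugation by [D] sends [X2] to a combination [C] of [X1 X2], [X2 X1] and
    the identity ([S1_rotl]). Its off-diagonal part holds because the ratio of
    consecutive values of [gamma] is an affine combination of the two values of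
    [chi] concerned, its diagonal part because the [i]-th diagonal entry of [X2]
    is inversely proportional to [q + q^-1 + chi (a + i)] ([X2_diag_central]). Transported by [P], which exchanges [X1] and [X2], it
    says that conjugation by [S2] sends [C] to [X1]. Hence [D S2 D] exchanges
    [X1] and [X2] by conjugation, just as [P] does.

    A matrix [Q] with [X2 Q = Q X1] and [X1 Q = Q X2] is determined by its entry
    [(0, 0)], since [X2] is tridiagonal with nonzero entries next to the diagonal
    ([X_intertwiner_eq0]). So [D S2 D] is a multiple of [P]. The multiple is read
    off in the first column of [P], which is constant: the entry [(N, 0)] of [S2]
    is the product of the subdiagonal entries of [X2] with the leading
    coefficient of the polynomial that interpolates [gamma] at the eigenvalues,
    and Neville's recursion gives that coefficient in closed form
    ([interp_leadS]).

    This argument applies to every [q] that is neither zero nor a root of unity,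
    in particular to the inverse of the given one. Inverting [q] leaves [X1] and
    [X2] as they are, hence also [P], by the uniqueness just mentioned
    ([P_mx_inv]), whereas it inverts [gamma], hence [S1] and [S2]. The second
    identity is therefore the first one for the inverse of [q]. *)

Section GenericBase.

Variable R : realFieldType.
Variable q : R.
Hypothesis q0 : q != 0.
Hypothesis qn1 : forall n, (0 < n)%N -> q ^+ n != 1.

(** * Powers of q *)

Let exprzD x y : q ^ (x + y) = q ^ x * q ^ y.
Proof. exact: expfzDr. Qed.

Lemma exprzN x : q ^ (- x) = (q ^ x)^-1.
Proof. by rewrite invr_expz. Qed.

Lemma exprz_mulnl n x : q ^ (n%:R * x) = (q ^ x) ^+ n.
Proof. by rewrite natz mulrC -exprz_exp -exprnP. Qed.

Lemma exprz_mulNnl n x : q ^ (- n%:R * x) = ((q ^ x) ^+ n)^-1.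
Proof. by rewrite mulNr exprzN exprz_mulnl. Qed.

Lemma exprz_natr n : q ^ (n%:R : int) = q ^+ n.
Proof. by rewrite natz. Qed.

Lemma exprz_Posz (n : nat) : q ^ n%:Z = q ^+ n.
Proof. by []. Qed.

Lemma exprn_mul n m : q ^+ (n * m) = (q ^+ m) ^+ n.
Proof. by rewrite mulnC exprM. Qed.

(** Rewriting with these rules turns a power of [q] with an affine exponent into
    a monomial in [q] and the [q ^+ i], which [ring] and [field] treat as
    indeterminates: identities between q-hypergeometric terms become rational
    ones. *)
Definition q_monomE := (exprzD, exprz_mulnl, exprz_mulNnl, exprzN, expr1z,
  exprz_natr, exprz_Posz, exprD, exprn_mul).

Lemma subr1_expz_neq0 x : x != 0 -> 1 - q ^ x != 0.
Proof.
move=> x0; rewrite subr_eq0 eq_sym; case: x x0 => n hn.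
  by apply: qn1; rewrite lt0n.
by rewrite NegzE exprzN invr_eq1 qn1.
Qed.

Lemma subr1_exp_neq0 n : (0 < n)%N -> 1 - q ^+ n != 0.
Proof. by move=> n0; rewrite subr_eq0 eq_sym qn1. Qed.

Lemma subr1_monom_neq0 n x : x = q ^+ n -> (0 < n)%N -> 1 - x != 0.
Proof. by move=> ->; apply: subr1_exp_neq0. Qed.

Lemma expBexp_neq0 m n : m != n -> q ^+ m - q ^+ n != 0.
Proof.
wlog lmn : m n / (m < n)%N => [h hmn|_].
  have [l|l] := ltnP m n; first exact: h.
  by rewrite -opprB oppr_eq0; apply: h; rewrite ?ltn_neqAle eq_sym ?hmn.
have -> : q ^+ m - q ^+ n = q ^+ m * (1 - q ^+ (n - m)).
  by rewrite mulrBr mulr1 -exprD subnKC // ltnW.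
by rewrite mulf_neq0 ?expf_neq0 // subr1_exp_neq0 // subn_gt0.
Qed.

(* Solves the side conditions that field leaves on the denominators; the argument
   is the total exponent of the monomial compared with 1. *)
Ltac monom_neq0 n :=
  rewrite -?(opprB 1) ?oppr_eq0; apply: (@subr1_monom_neq0 n);
  [rewrite ?q_monomE; ring | lia].

Lemma chiB_neq0 b c : b != c -> chi q b - chi q c != 0.
Proof.
move=> bc; have -> : chi q b - chi q c =
    (q ^+ (2 * b + 1) - q ^+ (2 * c + 1)) * (1 - (q ^+ (2 * b + 2 * c + 2))^-1).
  by rewrite /chi !q_monomE; field; rewrite ?(q0, expf_neq0).
rewrite mulf_neq0 ?expBexp_neq0 ?(inj_eq (@addIn _)) ?eqn_pmul2l //.
by rewrite subr_eq0 eq_sym invr_eq1 qn1 // addn2.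
Qed.

Lemma subq2_inv_neq0 : q ^+ 2 - q ^- 2 != 0.
Proof.
have -> : q ^+ 2 - q ^- 2 = (q ^+ 4 - q ^+ 0) * (q ^+ 2)^-1.
  by rewrite expr0; field; exact: q0.
by rewrite mulf_neq0 ?expBexp_neq0 ?invr_eq0 ?expf_neq0.
Qed.

(** * q-shifted factorials *)

Lemma qpoch0 zs p : qpoch zs p 0 = 1 :> R.
Proof. by rewrite /qpoch big1 // => z _; rewrite big_ord0. Qed.

Lemma qpochS zs p k :
  qpoch zs p k.+1 = qpoch zs p k * \prod_(z <- zs) (1 - z * p ^+ k) :> R.
Proof.
by rewrite /qpoch -big_split; apply: eq_bigr => z _ /=; rewrite big_ord_recr.
Qed.

Lemma qpoch_cat zs1 zs2 p k :
  qpoch (zs1 ++ zs2) p k = qpoch zs1 p k * qpoch zs2 p k :> R.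
Proof. exact: big_cat. Qed.

Lemma exprnAC2 k : (q ^+ 2) ^+ k = (q ^+ k) ^+ 2.
Proof. exact: exprAC. Qed.

Definition qfact z k : R := qpoch [:: z] (q ^+ 2) k.

Lemma qfactS z k : qfact z k.+1 = qfact z k * (1 - z * q ^+ (2 * k)).
Proof. by rewrite /qfact qpochS big_cons big_nil mulr1 exprM. Qed.

Lemma qfact_shift z k : qfact z k.+1 = (1 - z) * qfact (z * q ^+ 2) k.
Proof.
rewrite /qfact /qpoch !big_cons !big_nil !mulr1 big_ord_recl mulr1.
by congr (_ * _); apply: eq_bigr => i _; rewrite lift0 (exprS (q ^+ 2)) mulrA.
Qed.

Lemma qpoch2 z1 z2 k : qpoch [:: z1; z2] (q ^+ 2) k = qfact z1 k * qfact z2 k.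
Proof. exact: (qpoch_cat [:: _] [:: _]). Qed.

Lemma qfact_neq0 n k : (0 < n)%N -> qfact (q ^+ n) k != 0.
Proof.
move=> n0; elim: k => [|k IH]; first by rewrite /qfact qpoch0 oner_eq0.
by rewrite qfactS mulf_neq0 // -exprD subr1_exp_neq0 // addn_gt0 n0.
Qed.

(** * Tridiagonal coefficients *)

(** The general formula vanishes at the boundary [i = N], so that it needs no
    case distinction. *)
Lemma alpha_nextE a N i : (i <= N)%N ->
  alpha_next q a N i = alpha_up q a N i.+1.
Proof.
rewrite /alpha_next; case: ltnP => // hN hi.
have -> : i = N by apply/eqP; rewrite eqn_leq hi.
rewrite /alpha_up (_ : 2 * (N.+1%:Z - N%:Z - 1) = 0); last by lia.
by rewrite expr0z subrr mulr0 mul0r mulr0 mul0r.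
Qed.

Lemma alpha_next_neq0 a N i : (i < N)%N -> alpha_next q a N i != 0.
Proof.
move=> hi; rewrite alpha_nextE 1?ltnW // /alpha_up.
by rewrite !mulf_neq0 ?invr_eq0 ?mulf_neq0 ?subr1_expz_neq0 ?expfz_neq0 //; lia.
Qed.

Lemma alpha_prev_neq0 a N i : (i < N)%N -> alpha_prev q a N i.+1 != 0.
Proof.
move=> hi; rewrite /alpha_prev /alpha_down /=.
by rewrite !mulf_neq0 ?invr_eq0 ?mulf_neq0 ?subr1_expz_neq0 ?expfz_neq0 //; lia.
Qed.


(** * The q-Racah recurrence *)

(** These are the values at the grid point [i] of the Newton basis with nodes
    [chi (a + 0)], [chi (a + 1)], ..., up to scalars (see [newtonS]); the
    q-Racah polynomials are diagonal in the product of this basis with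
    itself. *)
Definition newton a k i : R :=
  qpoch [:: q ^ (- 2 * i%:Z); q ^ (2 * (2 * a%:Z + 1 + i%:Z))] (q ^+ 2) k.

Lemma newton0 a i : newton a 0 i = 1.
Proof. exact: qpoch0. Qed.

Lemma newtonS a k i : newton a k.+1 i =
  q ^+ (2 * k + 2 * a + 1) * (chi q (a + k) - chi q (a + i)) * newton a k i.
Proof.
rewrite /newton qpochS mulrC !big_cons big_nil; congr (_ * _).
by rewrite /chi exprnAC2 !q_monomE; field; rewrite ?(q0, expf_neq0).
Qed.

Lemma newton_small a k i : (i < k)%N -> newton a k i = 0.
Proof.
elim: k => // k IH; rewrite ltnS leq_eqVlt => /orP[/eqP ->|h]; rewrite newtonS.
  by rewrite subrr mulr0 mul0r.
by rewrite IH // mulr0.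
Qed.

(** Moving the grid point by one shifts the two q-shifted factorials in opposite
    directions, so that all but boundary factors cancel. *)
Lemma newton_next a k i :
  newton a k.+1 i.+1 * (1 - q ^+ (2 * (2 * a + 1 + i))) =
  (1 - (q ^+ (2 * i.+1))^-1) * (1 - q ^+ (2 * (2 * a + i + k + 1))) *
  (1 - q ^+ (2 * (2 * a + 2 + i + k))) * newton a k i.
Proof.
rewrite /newton !qpoch2 qfact_shift qfactS.
set x := q ^ (-2 * i.+1%:Z) * _.
set y := q ^ (2 * (_ + i.+1%:Z)); set y' := q ^ (2 * (_ + i%:Z)).
have -> : q ^ (-2 * i%:Z) = x.
  by rewrite /x !q_monomE (exprS q i); field; rewrite ?(q0, expf_neq0).
have ey : y = y' * q ^+ 2 by rewrite /y /y' !q_monomE (exprS q i); ring.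
have e : qfact y k * (1 - y') = qfact y' k * (1 - y' * q ^+ (2 * k)).
  by rewrite ey mulrC -qfact_shift qfactS.
transitivity ((1 - (q ^+ (2 * i.+1))^-1) * qfact x k *
    (1 - y * q ^+ (2 * k)) * (qfact y k * (1 - y'))).
  by rewrite /y' !q_monomE; ring.
by rewrite e /y /y' !q_monomE (exprS q i); ring.
Qed.

Lemma newton_prev a k i :
  newton a k.+1 i * (1 - (q ^+ (2 * i.+1))^-1) =
  (1 - q ^+ (2 * (2 * a + 1 + i))) * (1 - q ^ (2 * (k%:Z - i.+1%:Z))) *
  (1 - q ^ (2 * (k%:Z - i%:Z))) * newton a k i.+1.
Proof.
rewrite /newton !qpoch2 qfactS (qfact_shift (q ^ (2 * _))).
set y := q ^ (2 * (_ + i.+1%:Z)).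
set x := q ^ (-2 * i%:Z); set x' := q ^ (-2 * i.+1%:Z).
have -> : q ^ (2 * (2 * a%:Z + 1 + i%:Z)) * q ^+ 2 = y.
  by rewrite /y !q_monomE (exprS q i); ring.
have ex : x = x' * q ^+ 2.
  by rewrite /x /x' !q_monomE (exprS q i); field; rewrite ?(q0, expf_neq0).
have e : qfact x k * (1 - x') = qfact x' k * (1 - x' * q ^+ (2 * k)).
  by rewrite ex mulrC -qfact_shift qfactS.
have -> : (q ^+ (2 * i.+1))^-1 = x' by rewrite /x' !q_monomE.
transitivity ((1 - x * q ^+ (2 * k)) * (1 - q ^+ (2 * (2 * a + 1 + i))) *
    qfact y k * (qfact x k * (1 - x'))).
  by rewrite !q_monomE; ring.
by rewrite e /x /x' !q_monomE (exprS q i); field; rewrite ?(q0, expf_neq0).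
Qed.

(** Off-diagonal coefficient of the difference operator in the Newton basis. *)
Definition lower a N k :=
  (1 - q ^+ (2 * (a + k + 1))) * (1 - q ^ (2 * (k%:Z - N%:Z))) *
  (1 - q ^+ (2 * (3 * a + N + 2 + k))) * (1 - q ^+ (2 * (k + 1))) /
  q ^+ (2 * k + 2 * a + 3).

(** The difference operator [X2 - chi a] is bidiagonal in the Newton basis: all
    terms have the factor [newton a k i], and what remains is an identity of
    rational functions. *)
Lemma newton_rec a N k i : (i <= N)%N ->
  alpha_next q a N i * (newton a k.+1 i.+1 - newton a k.+1 i)
   + alpha_prev q a N i * (newton a k.+1 i.-1 - newton a k.+1 i)
  = (chi q (a + k.+1) - chi q a) * newton a k.+1 i - lower a N k * newton a k i.
Proof.
move=> hi; rewrite alpha_nextE // /alpha_prev.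
have d1 : 1 - q ^+ (2 * (2 * a + 1 + i)) != 0 by apply: subr1_exp_neq0; lia.
have -> : newton a k.+1 i.+1 =
    (1 - (q ^+ (2 * i.+1))^-1) * (1 - q ^+ (2 * (2 * a + i + k + 1))) *
    (1 - q ^+ (2 * (2 * a + 2 + i + k))) * newton a k i /
    (1 - q ^+ (2 * (2 * a + 1 + i))).
  by rewrite -newton_next mulfK.
case: i hi d1 => [|i] hi d1.
  (* There is no point to the left of 0, where only newton a 0 0 is nonzero. *)
  rewrite mul0r addr0 newtonS; case: k => [|k]; last first.
    by rewrite (@newton_small a k.+1 0) // !(mulr0, mul0r) subrr mulr0.
  rewrite /alpha_up /chi /lower; move: d1.
  rewrite ?q_monomE expr0 expr1 ?mulr1 => d1.
  field; rewrite ?(q0, expf_neq0) //=.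
  by apply/andP; split; [monom_neq0 (4 * a + 2)%N | monom_neq0 (4 * a + 4)%N].
have -> : newton a k.+1 i =
    (1 - q ^+ (2 * (2 * a + 1 + i))) * (1 - q ^ (2 * (k%:Z - i.+1%:Z))) *
    (1 - q ^ (2 * (k%:Z - i%:Z))) * newton a k i.+1 /
    (1 - (q ^+ (2 * i.+1))^-1).
  by rewrite -newton_prev mulfK // subr_eq0 eq_sym invr_eq1 qn1.
rewrite !newtonS /= /alpha_up /alpha_down /chi /lower; move: d1.
rewrite ?q_monomE (exprS q i.+1) (exprS q i) (exprS q k) => d1.
field; rewrite ?(q0, expf_neq0) //=.
apply/and5P; split.
- monom_neq0 (2 * i + 2)%N.
- monom_neq0 (4 * i + 4 * a + 6)%N.
- monom_neq0 (4 * i + 4 * a + 4)%N.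
- monom_neq0 (4 * a + 4 + 2 * i)%N.
- monom_neq0 (4 * i + 4 * a + 8)%N.
Qed.

Definition racah_coef a N k : R :=
  q ^+ (2 * k) /
  (qpoch [:: q ^ (2 * (a%:Z + 1)); q ^ (- 2 * N%:Z);
             q ^ (2 * (3 * a%:Z + N%:Z + 2))] (q ^+ 2) k *
   qpoch [:: q ^+ 2] (q ^+ 2) k).

Lemma qRacah_newton a N i j : (i <= N)%N -> (j <= N)%N ->
  qRacah q a N i j =
  \sum_(k < N.+1) racah_coef a N k * (newton a k i * newton a k j).
Proof.
move=> hi hj; have hm : ((minn i j).+1 <= N.+1)%N by lia.
pose F k := racah_coef a N k * (newton a k i * newton a k j).
transitivity (\sum_(k < (minn i j).+1) F k).
  apply: eq_bigr => k _.
  by rewrite (qpoch_cat [:: _; _] [:: _; _]) /F /racah_coef /newton invfM; ring.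
rewrite (big_ord_widen N.+1 F hm) big_mkcond; apply: eq_bigr => k _.
case: ltnP => // hk; rewrite -/(F k) /F.
by case: (leqP i j) (hk) => hij hk';
  [rewrite (@newton_small a k i) | rewrite (@newton_small a k j)];
  rewrite ?mul0r ?mulr0 //; lia.
Qed.

Lemma qRacahC a N i j : qRacah q a N i j = qRacah q a N j i.
Proof.
rewrite /qRacah minnC; apply: eq_bigr => k _.
rewrite (qpoch_cat [:: _; _] [:: _; _]) (qpoch_cat [:: _; _] [:: _; _]).
by rewrite [X in X / _]mulrC.
Qed.

Lemma qRacah_r0 a N i : qRacah q a N i 0 = 1.
Proof.
by rewrite /qRacah minn0 big_ord1 /= !qpoch0 muln0 expr0 !divr1 mulr1.
Qed.

Lemma qRacah_0l a N j : qRacah q a N 0 j = 1.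
Proof. by rewrite qRacahC qRacah_r0. Qed.

(** The coefficients of the 4phi3 series are tuned so that the lowering terms
    produced by the recurrence in [i] are those of the multiplication by
    [chi (a + j)]. *)
Lemma racah_coefS a N k : (k < N)%N ->
  racah_coef a N k.+1 * lower a N k * q ^+ (2 * k + 2 * a + 1) =
  racah_coef a N k.
Proof.
move=> hk; rewrite /racah_coef !qpochS !big_cons !big_nil !mulr1.
set A := qpoch _ _ _; set B := qpoch _ _ _.
have [A0|A0] := eqVneq A 0; first by rewrite A0 !mul0r invr0 !mulr0 !mul0r.
have [B0|B0] := eqVneq B 0.
  by rewrite B0 !mul0r !mulr0 invr0 !mulr0 !mul0r.
rewrite /lower exprnAC2 !q_monomE (exprS q k); field.
rewrite ?(q0, expf_neq0) //= A0 B0 /=.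
apply/and4P; split.
- monom_neq0 (2 * k + 2)%N.
- monom_neq0 (6 * a + 2 * N + 4 + 2 * k)%N.
- by rewrite -!exprn_mul expBexp_neq0 //; lia.
- monom_neq0 (2 * a + 2 + 2 * k)%N.
Qed.

Lemma qRacah_rec a N i j : (i <= N)%N -> (j <= N)%N ->
  alpha_next q a N i * (qRacah q a N i.+1 j - qRacah q a N i j)
   + alpha_prev q a N i * (qRacah q a N i.-1 j - qRacah q a N i j)
  = (chi q (a + j) - chi q a) * qRacah q a N i j.
Proof.
move=> hi hj.
pose Q i := \sum_(k < N.+1) racah_coef a N k * (newton a k i * newton a k j).
have hQ i' : (i' <= N)%N -> qRacah q a N i' j = Q i'.
  by move=> h; rewrite qRacah_newton.
have -> : alpha_next q a N i * (qRacah q a N i.+1 j - qRacah q a N i j) =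
          alpha_next q a N i * (Q i.+1 - Q i).
  rewrite /alpha_next; case: ltnP => hiN; last by rewrite !mul0r.
  by rewrite !hQ.
rewrite !hQ ?(leq_trans (leq_pred _)) //.
have lo k : q ^+ (2 * k + 2 * a + 1) != 0 by rewrite expf_neq0.
pose V k := racah_coef a N k * newton a k i *
            ((chi q (a + k) - chi q a) * newton a k j).
pose W k := racah_coef a N k * newton a k i *
            (newton a k.+1 j / q ^+ (2 * k + 2 * a + 1)).
transitivity (\sum_(k < N.+1) V k - \sum_(k < N.+1) W k); last first.
  rewrite -sumrB /Q mulr_sumr; apply: eq_bigr => k _; rewrite /V /W newtonS.
  by rewrite -[q ^+ _ * _ * _]mulrA [q ^+ _ * _]mulrC mulfK //; ring.
have -> : \sum_(k < N.+1) V k = V 0%N + \sum_(k < N) V k.+1.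
  by rewrite big_ord_recl.
have -> : \sum_(k < N.+1) W k = \sum_(k < N) W k + W N by rewrite big_ord_recr.
have -> : V 0%N = 0 by rewrite /V addn0 subrr mul0r mulr0.
have -> : W N = 0 by rewrite /W (@newton_small a N.+1 j) // mul0r mulr0.
rewrite /Q -!sumrB !mulr_sumr -big_split /= big_ord_recl /= !newton0.
rewrite !subrr !mulr0 !add0r addr0 -sumrB; apply: eq_bigr => k _.
rewrite /bump leq0n !add1n /V /W -(@racah_coefS a N k) //.
transitivity (racah_coef a N k.+1 * newton a k.+1 j *
  (alpha_next q a N i * (newton a k.+1 i.+1 - newton a k.+1 i)
   + alpha_prev q a N i * (newton a k.+1 i.-1 - newton a k.+1 i))).
  by ring.
by rewrite newton_rec //; field; rewrite ?(q0, expf_neq0).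
Qed.

(** * The weights *)

Lemma beta2_0 a N : beta2 q a N 0 = 1.
Proof. by rewrite /beta2 !qpoch0 mulr0 mul0r expr0z !mul1r invr1. Qed.

(** Detailed balance: [beta2] is a reversible measure for [X2]. *)
Lemma beta2S a N i : (i < N)%N ->
  beta2 q a N i.+1 * alpha_prev q a N i.+1 = beta2 q a N i * alpha_next q a N i.
Proof.
move=> hi; rewrite alpha_nextE 1?ltnW // /alpha_prev /= /beta2.
rewrite !qpochS !big_cons !big_nil !mulr1.
set A := qpoch _ _ _; set B := qpoch _ _ _.
have e k : q ^ (-2 * k%:Z * (2 * a%:Z + 1)) = (q ^+ (2 * k * (2 * a + 1)))^-1.
  by rewrite exprnP invr_expz; congr (_ ^ _); lia.
have -> := e i.+1; rewrite e.
have -> : (2 * i.+1 * (2 * a + 1) = 2 * i * (2 * a + 1) + (4 * a + 2))%N by lia.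
rewrite exprD; have : q ^+ (2 * i * (2 * a + 1)) != 0 by rewrite expf_neq0.
move: (q ^+ (2 * i * (2 * a + 1))) => E E0.
have [B0|B0] := eqVneq B 0; first by rewrite B0 !mul0r !invr0 !mulr0 !mul0r.
rewrite /alpha_up /alpha_down exprnAC2 !q_monomE (exprS q i); field.
rewrite ?(q0, expf_neq0) //= ?E0 ?B0 /=.
apply/and5P; split; last apply/and4P; try split.
- monom_neq0 (4 * i + 4 * a + 4)%N.
- monom_neq0 (4 * i + 4 * a + 2)%N.
- monom_neq0 (4 * i + 4 * a + 6)%N.
- monom_neq0 (4 * a + 2 * N + 2 * i + 4)%N.
- by rewrite -exprD -!exprn_mul expBexp_neq0 //; lia.
- have : 1 - q ^+ (2 * (2 * a + 1 + 2 * i)) != 0 by apply: subr1_exp_neq0; lia.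
  apply: contraNneq => h.
  have -> : 1 - q ^+ (2 * (2 * a + 1 + 2 * i)) =
      (1 - q ^+ (2 * a + 1 + 2 * i)) *
      (1 - - (q ^+ a ^+ 2 * q) * q ^+ i ^+ 2).
    by rewrite !q_monomE; ring.
  by rewrite h mulr0.
- monom_neq0 (2 * a + 1 + 2 * i)%N.
- monom_neq0 (2 * i + 2)%N.
Qed.

Lemma beta2_neq0 a N i : (i <= N)%N -> beta2 q a N i != 0.
Proof.
elim: i => [|i IH] hi; first by rewrite beta2_0 oner_eq0.
have : beta2 q a N i * alpha_next q a N i != 0.
  by rewrite mulf_neq0 ?IH ?alpha_next_neq0 // ltnW.
by rewrite -beta2S // mulf_eq0 negb_or => /andP[].
Qed.

(** * The diagonal of X2 *)

(** In terms of the spins, this is [c_s * (c_s + c_l)], where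
    [c_s = q ^ (2s+1) + q ^ (-2s-1)] is the common value of the Casimir elements
    of the three factors and [c_l] that of the total Casimir element. It is the
    central element of the Askey-Wilson relations, the same in all three because
    the three spins are equal. *)
Definition central a N : R :=
  (q ^+ (a + N + 1) + q ^- (a + N + 1)) *
  (q ^+ (a + N + 1) + q ^- (a + N + 1)
   + q ^+ (3 * a + N + 1) + q ^- (3 * a + N + 1)).

Lemma X2_diag_central a N i : (i <= N)%N ->
  (chi q a - (alpha_next q a N i + alpha_prev q a N i)) *
    (q + q^-1 + chi q (a + i)) = central a N.
Proof.
move=> hi; rewrite alpha_nextE // /alpha_prev /central.
case: i hi => [|i] hi.
  rewrite ltnn /alpha_up /chi !q_monomE expr0 ?expr1; field.
  rewrite ?(q0, expf_neq0) //=.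
  by apply/andP; split; [monom_neq0 (4 * a + 4)%N | monom_neq0 (4 * a + 2)%N].
rewrite /= /alpha_up /alpha_down /chi.
rewrite !q_monomE (exprS q i.+1) (exprS q i); field.
rewrite ?(q0, expf_neq0) //=.
apply/and3P; split.
- monom_neq0 (4 * i + 4 * a + 6)%N.
- monom_neq0 (4 * i + 4 * a + 4)%N.
- monom_neq0 (4 * i + 4 * a + 8)%N.
Qed.

Lemma gammaS a i : gamma q a i.+1 = - q ^+ (2 * i + 2 * a + 2) * gamma q a i.
Proof.
rewrite /gamma (_ : (i.+1 * (i.+1 + 2 * a + 1))%N =
    (i * (i + 2 * a + 1) + (2 * i + 2 * a + 2))%N); last by lia.
by rewrite exprS exprD; ring.
Qed.

Lemma gamma0 a : gamma q a 0 = 1.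
Proof. by rewrite /gamma expr0 mul0n expr0 mulr1. Qed.

Lemma gamma_neq0 a i : gamma q a i != 0.
Proof. by rewrite /gamma mulf_neq0 ?expf_neq0 // oppr_eq0 oner_eq0. Qed.

(** The exponents in [gamma] are such that its ratio at two neighbours is an
    affine combination of the two eigenvalues [chi]. *)
Lemma gamma_rot a (i j : nat) : (j == i.+1) || (i == j.+1) ->
  gamma q a i = - (q ^+ 2 - q ^- 2)^-1 *
    (q * chi q (a + i) - q^-1 * chi q (a + j)) * gamma q a j.
Proof.
have d0 := subq2_inv_neq0; set d := _ - _ in d0 *.
case/orP=> /eqP ->; rewrite gammaS.
  have -> : q * chi q (a + i) - q^-1 * chi q (a + i.+1) =
      d / q ^+ (2 * i + 2 * a + 2).
    by rewrite /d /chi !q_monomE (exprS q i); field; rewrite ?(q0, expf_neq0).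
  by field; rewrite d0 ?(q0, expf_neq0).
have -> : q * chi q (a + j.+1) - q^-1 * chi q (a + j) =
    d * q ^+ (2 * j + 2 * a + 2).
  by rewrite /d /chi !q_monomE (exprS q j); field; rewrite ?(q0, expf_neq0).
by field.
Qed.

(** * The tridiagonal matrix X2 *)

Lemma X2E a N (i k : 'I_N.+1) : X2 q a N i k =
  (if k == i.+1 :> nat then alpha_next q a N i else 0) +
  (if k == i :> nat
   then chi q a - (alpha_next q a N i + alpha_prev q a N i) else 0) +
  (if i == k.+1 :> nat then alpha_prev q a N i else 0).
Proof.
rewrite mxE -val_eqE /= [(i : nat) == k]eq_sym.
case: eqVneq => [h1|h1].
  by rewrite !ifN ?addr0 // h1; lia.
case: eqVneq => [h2|h2]; first by rewrite ifN ?add0r // h2; lia.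
by case: eqVneq => h3; rewrite add0r addr0.
Qed.

Lemma X2_mul a N (i : 'I_N.+1) (f : nat -> R) :
  \sum_(k < N.+1) X2 q a N i k * f k =
  alpha_next q a N i * (f i.+1 - f i) + alpha_prev q a N i * (f i.-1 - f i)
  + chi q a * f i.
Proof.
have sel m c : \sum_(k < N.+1) (if k == m :> nat then c else 0) * f k =
    if (m < N.+1)%N then c * f m else 0.
  transitivity (\sum_(k < N.+1 | k == m :> nat) c * f k).
    rewrite [RHS]big_mkcond; apply: eq_bigr => k _.
    by case: eqP => // _; rewrite mul0r.
  exact: (big_ord1_eq _ (fun k => c * f k)).
transitivity (\sum_(k < N.+1)
    ((if k == i.+1 :> nat then alpha_next q a N i else 0) * f k +
     (if k == i :> nat
      then chi q a - (alpha_next q a N i + alpha_prev q a N i) else 0) * f k +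
     (if k == i.-1 :> nat then alpha_prev q a N i else 0) * f k)).
  apply: eq_bigr => k _; rewrite X2E !mulrDl; congr (_ + _ * _).
  rewrite /alpha_prev; case: (i : nat) => [|i'] /=; first by case: ifP.
  by rewrite eqSS eq_sym.
rewrite !big_split /= !sel ltn_ord (leq_ltn_trans (leq_pred i)) // ltnS.
by rewrite /alpha_next; case: ltnP => _; ring.
Qed.

Lemma X2_balance a N (i j : 'I_N.+1) :
  beta2 q a N i * X2 q a N i j = beta2 q a N j * X2 q a N j i.
Proof.
wlog ij : i j / (i < j)%N => [h|].
  case: (ltngtP i j) => [/h //|/h //|/val_inj -> //].
rewrite !X2E [X in _ = _ * X](_ : _ = alpha_prev q a N j *+ (j == i.+1 :> nat)).
  rewrite (gtn_eqF ij) addr0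
    (_ : (i == j.+1 :> nat) = false) ?addr0; last by lia.
  case: eqP => [e|_]; last by rewrite !mulr0.
  by rewrite e mulr1n beta2S // -ltnS -e.
rewrite (ltn_eqF ij) addr0 (_ : (i == j.+1 :> nat) = false) ?add0r; last by lia.
by case: eqP.
Qed.

Lemma P_mx_col0 a N i : P_mx q a N i 0 = 1.
Proof. by rewrite mxE beta2_0 qRacah_r0 mulr1. Qed.

(** The columns of [P_mx] are eigenvectors of [X2]: this is the recurrence of
    the q-Racah polynomials. *)
Lemma X2_P_mx a N : X2 q a N *m P_mx q a N = P_mx q a N *m X1 q a N.
Proof.
apply/matrixP => i j; rewrite mul_mx_diag !mxE.
pose f k := beta2 q a N j * qRacah q a N k j.
transitivity (\sum_(k < N.+1) X2 q a N i k * f k).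
  by apply: eq_bigr => k _; rewrite [P_mx _ _ _ _ _]mxE.
rewrite X2_mul /f -!mulrBr !(mulrCA _ (beta2 _ _ _ _)) -!mulrDr.
rewrite qRacah_rec ?leq_ord //.
move: (beta2 _ _ _ _) (qRacah _ _ _ _ _) (chi _ (a + j)) (chi _ a) => b r x y.
by ring.
Qed.

(** Self-duality: the q-Racah polynomials are symmetric in degree and grid
    point, and transposing [X2_P_mx] through the reversible weights [beta2]
    exchanges the roles of [X1] and [X2]. *)
Lemma X1_P_mx a N : X1 q a N *m P_mx q a N = P_mx q a N *m X2 q a N.
Proof.
apply/matrixP => i j; rewrite mul_diag_mx !mxE.
pose f k := qRacah q a N k i.
transitivity (\sum_(k < N.+1) beta2 q a N j * (X2 q a N j k * f k)).
  rewrite -mulr_sumr X2_mul /f qRacah_rec ?leq_ord // (qRacahC a N i j).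
  move: (beta2 _ _ _ _) (qRacah _ _ _ _ _) (chi _ (a + i)) (chi _ a) => b r x y.
  by ring.
apply: eq_bigr => k _; rewrite mulrA -X2_balance [P_mx _ _ _ _ _]mxE.
by rewrite (qRacahC a N i k) /f mulrAC.
Qed.

(** * Functions of X1 and X2 *)

Lemma intertwineB {n : nat} (A B P : 'M[R]_n.+1) c :
  A *m P = P *m B -> (A - c%:M) *m P = P *m (B - c%:M).
Proof.
by move=> h; rewrite mulmxBl mulmxBr h mul_scalar_mx mul_mx_scalar.
Qed.

Lemma mul_prod_eigen (n : nat) (I : finType) (p : pred I)
    (F : I -> 'M[R]_n.+1) (c : I -> R) (v : 'cV[R]_n.+1) :
  (forall k, p k -> F k *m v = c k *: v) ->
  (\prod_(k | p k) F k) *m v = (\prod_(k | p k) c k) *: v.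
Proof.
move=> h; apply: (big_rec2 (fun A x => A *m v = x *: v)) => [|k x A pk e].
  by rewrite mul1mx scale1r.
by rewrite -mulmxE -mulmxA e -scalemxAr h // scalerA mulrC.
Qed.

(** The spectral projection of [X] for the eigenvalue [chi (a + r)]. *)
Definition lagrange a {N} (X : 'M[R]_N.+1) (r : 'I_N.+1) : 'M[R]_N.+1 :=
  \prod_(k < N.+1 | k != r)
    ((chi q (a + r) - chi q (a + k))^-1 *: (X - (chi q (a + k))%:M)).

Lemma lagrange_intertwine a N (A B P : 'M[R]_N.+1) r :
  A *m P = P *m B -> lagrange a A r *m P = P *m lagrange a B r.
Proof.
move=> h; rewrite /lagrange.
apply: (big_ind2 (fun A B => A *m P = P *m B)) => [|A1 B1 A2 B2 h1 h2|k _].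
- by rewrite mul1mx mulmx1.
- by rewrite -!mulmxE -mulmxA h2 mulmxA h1 mulmxA.
- by rewrite -scalemxAl -scalemxAr (intertwineB _ _ _ _ h).
Qed.

Lemma S_of_intertwine a N (A B P : 'M[R]_N.+1) :
  A *m P = P *m B -> S_of q a A *m P = P *m S_of q a B.
Proof.
move=> h; rewrite mulmx_suml mulmx_sumr; apply: eq_bigr => r _.
by rewrite -scalemxAl -scalemxAr (lagrange_intertwine _ _ _ _ _ _ h).
Qed.

Lemma X1_delta a N (j : 'I_N.+1) :
  X1 q a N *m delta_mx j 0 = chi q (a + j) *: (delta_mx j 0 : 'cV_N.+1).
Proof.
apply/matrixP => i k; rewrite mul_diag_mx !mxE.
by case: eqP => [->|]; rewrite ?mulr0.
Qed.

Lemma mx_delta_eq (n : nat) (A B : 'M[R]_n) :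
  (forall j, A *m (delta_mx j 0 : 'cV_n) = B *m delta_mx j 0) -> A = B.
Proof.
move=> h; apply/matrixP => i j.
by have /matrixP/(_ i 0) := h j; rewrite -!colE !mxE.
Qed.

Lemma lagrange_X1 a N r : lagrange a (X1 q a N) r = delta_mx r r.
Proof.
apply: mx_delta_eq => j; rewrite (@mul_prod_eigen _ _ _ _
  (fun k : 'I_N.+1 => (chi q (a + j) - chi q (a + k)) /
                      (chi q (a + r) - chi q (a + k)))); last first.
  move=> k _; rewrite -scalemxAl mulmxBl X1_delta mul_scalar_mx -scalerBl.
  by rewrite scalerA mulrC.
rewrite mul_delta_mx_cond; have [<-|rj] := eqVneq r j.
  rewrite mulr1n big1 ?scale1r // => k kr; rewrite divff //.
  by rewrite chiB_neq0 // eqn_add2l eq_sym.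
by rewrite mulr0n (bigD1 j) 1?eq_sym //= subrr !mul0r scale0r.
Qed.

Lemma S1E a N : S1 q a N = diag_mx (\row_(i < N.+1) gamma q a i).
Proof.
have -> : S1 q a N = \sum_(r < N.+1) gamma q a r *: delta_mx r r.
  by apply: eq_bigr => r _; rewrite -(lagrange_X1 a).
apply/matrixP => i j; rewrite summxE (bigD1 i) //= big1 ?addr0 => [|k ki].
  by rewrite !mxE eqxx eq_sym mulr_natr.
by rewrite !mxE [i == k]eq_sym (negPf ki) mulr0.
Qed.

Lemma S2_P_mx a N : S2 q a N *m P_mx q a N = P_mx q a N *m S1 q a N.
Proof. exact/S_of_intertwine/X2_P_mx. Qed.

(** The columns of [P_mx] are nonzero eigenvectors of [X2] for distinct
    eigenvalues. *)
Lemma P_mx_unit a N : P_mx q a N \in unitmx.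
Proof.
rewrite -unitmx_tr unitmxE unitfE; apply/det0P => -[v v0 hv].
have Pv : P_mx q a N *m v^T = 0.
  by rewrite -[P_mx _ _ _]trmxK -trmx_mul hv trmx0.
case/negP: v0; apply/eqP/rowP => r; rewrite mxE.
have : P_mx q a N *m (lagrange a (X1 q a N) r *m v^T) = 0.
  rewrite mulmxA -(lagrange_intertwine _ _ _ _ _ _ (X2_P_mx a N)) -mulmxA Pv.
  by rewrite mulmx0.
rewrite lagrange_X1 -(mul_delta_mx (0 : 'I_1)) -mulmxA -rowE mulmxA -colE.
move/matrixP/(_ 0 0); rewrite !mxE big_ord1 !mxE qRacah_0l mulr1 => /eqP.
by rewrite mulf_eq0 (negPf (beta2_neq0 _ _ _ _)) ?leq_ord //= => /eqP.
Qed.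

(** * The Askey-Wilson rotations *)

(** For [A] and [B] the Casimir elements C12 and C23, in either order, this is
    one of the two versions of C13: the Askey-Wilson relation solved for its third
    generator. *)
Definition casimir13 a {N} (A B : 'M[R]_N.+1) : 'M[R]_N.+1 :=
  (central a N / (q + q^-1))%:M -
  (q ^+ 2 - q ^- 2)^-1 *: (q *: (A *m B) - q^-1 *: (B *m A)).

Lemma casimir13_intertwine a N (A B A' B' P : 'M[R]_N.+1) :
  A *m P = P *m A' -> B *m P = P *m B' ->
  casimir13 a A B *m P = P *m casimir13 a A' B'.
Proof.
move=> hA hB; rewrite /casimir13 mulmxBl mulmxBr mul_scalar_mx mul_mx_scalar.
rewrite -scalemxAl -scalemxAr mulmxBl mulmxBr -!scalemxAl -!scalemxAr.
by rewrite -!mulmxA hA hB !mulmxA hA hB.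
Qed.

Lemma X2_tridiag a N (i j : 'I_N.+1) :
  ~~ [|| i == j, j == i.+1 :> nat | i == j.+1 :> nat] -> X2 q a N i j = 0.
Proof.
case/norP => /negPf h0 /norP[/negPf h1 /negPf h2].
by rewrite X2E h1 h2 -val_eqE eq_sym /= in h0 *; rewrite h0 !addr0.
Qed.

(** Entrywise form of the rotations, to be used for [x] an entry of [X2] in
    position [(i, j)] or [(j, i)]. *)
Lemma gamma_rot_tridiag a N (i j : 'I_N.+1) x :
  (i = j -> x * (q + q^-1 + chi q (a + i)) = central a N) ->
  (~~ [|| i == j, j == i.+1 :> nat | i == j.+1 :> nat] -> x = 0) ->
  gamma q a i * x =
  (central a N / (q + q^-1) *+ (i == j) - (q ^+ 2 - q ^- 2)^-1 *
    (q * chi q (a + i) - q^-1 * chi q (a + j)) * x) * gamma q a j.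
Proof.
move=> hd h0; have [ij|nij] := eqVneq i j.
  rewrite -ij mulr1n mulrC -hd //; congr (_ * _).
  have : q ^+ 2 - q ^- 2 = (q + q^-1) * (q - q^-1) by field; exact: q0.
  have := subq2_inv_neq0; move: (_ - _ ^- 2) => d d0 ed.
  move: d0; rewrite ed mulf_eq0 negb_or => /andP[e0 f0].
  rewrite -mulrBl; move: (q + _) (q - _) e0 f0 => e f e0 f0.
  by field; rewrite e0 f0.
rewrite mulr0n sub0r.
have [h|h] := boolP ((j == i.+1 :> nat) || (i == j.+1 :> nat)).
  by rewrite (gamma_rot _ _ _ h) !mulrA mulNr; ring.
by rewrite h0 ?(negPf nij) // !mulr0 oppr0 mul0r.
Qed.

Lemma X2_diagE a N (i : 'I_N.+1) :
  X2 q a N i i * (q + q^-1 + chi q (a + i)) = central a N.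
Proof.
rewrite X2E (ltn_eqF (ltnSn i)) eqxx add0r addr0.
by rewrite X2_diag_central // leq_ord.
Qed.

(** Conjugation by [S1] sends [X2] to one version of C13, and the inverse
    conjugation sends it to the other. *)
Lemma S1_rotl a N :
  S1 q a N *m X2 q a N = casimir13 a (X1 q a N) (X2 q a N) *m S1 q a N.
Proof.
apply/matrixP => i j; have := gamma_rot_tridiag a N i j (X2 q a N i j).
have hd : i = j -> X2 q a N i j * (q + q^-1 + chi q (a + i)) = central a N.
  by move=> <-; apply: X2_diagE.
move=> /(_ hd (X2_tridiag _ _ _ _)).
rewrite S1E /casimir13 /X1 !mul_diag_mx !mul_mx_diag.
move: (X2 q a N) (central _ _ / _) => Y w h; rewrite !mxE h; congr (_ * _).
move: (w *+ _) (chi _ _) (chi _ _) (Y i j) (_ - _ ^- 2) => ? ? ? ? ?; ring.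
Qed.

Lemma S1_rotr a N :
  X2 q a N *m S1 q a N = S1 q a N *m casimir13 a (X2 q a N) (X1 q a N).
Proof.
apply/matrixP => i j; have := gamma_rot_tridiag a N j i (X2 q a N i j).
have hd : j = i -> X2 q a N i j * (q + q^-1 + chi q (a + j)) = central a N.
  by move=> ->; apply: X2_diagE.
have h0 : ~~ [|| j == i, i == j.+1 :> nat | j == i.+1 :> nat] ->
    X2 q a N i j = 0.
  by rewrite eq_sym [X in _ || X]orbC; apply: X2_tridiag.
move=> /(_ hd h0).
rewrite S1E /casimir13 /X1 !mul_diag_mx !mul_mx_diag.
move: (X2 q a N) (central _ _ / _) => Y w h; rewrite !mxE mulrC h mulrC.
rewrite eq_sym; congr (_ * _).
move: (w *+ _) (chi _ _) (chi _ _) (Y i j) (_ - _ ^- 2) => ? ? ? ? ?; ring.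
Qed.

Lemma casimir13_P_mx a N :
  casimir13 a (X1 q a N) (X2 q a N) *m P_mx q a N =
  P_mx q a N *m casimir13 a (X2 q a N) (X1 q a N).
Proof. exact: casimir13_intertwine (X1_P_mx a N) (X2_P_mx a N). Qed.

Lemma casimir13_P_mx' a N :
  casimir13 a (X2 q a N) (X1 q a N) *m P_mx q a N =
  P_mx q a N *m casimir13 a (X1 q a N) (X2 q a N).
Proof. exact: casimir13_intertwine (X2_P_mx a N) (X1_P_mx a N). Qed.

(** [P_mx] carries the rotations by [S1] to rotations by [S2], with [X1] and [X2]
    exchanged; this also exchanges the two versions of C13. *)
Lemma S2_rotl a N :
  S2 q a N *m casimir13 a (X1 q a N) (X2 q a N) = X1 q a N *m S2 q a N.
Proof.
apply: (can_inj (mulmxK (P_mx_unit a N))).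
rewrite -mulmxA casimir13_P_mx mulmxA S2_P_mx -mulmxA -S1_rotr.
by rewrite mulmxA -X1_P_mx -!mulmxA S2_P_mx.
Qed.

Lemma S2_rotr a N :
  S2 q a N *m X1 q a N = casimir13 a (X2 q a N) (X1 q a N) *m S2 q a N.
Proof.
apply: (can_inj (mulmxK (P_mx_unit a N))).
rewrite -mulmxA X1_P_mx mulmxA S2_P_mx -mulmxA S1_rotl.
by rewrite mulmxA -casimir13_P_mx' -!mulmxA S2_P_mx.
Qed.

Lemma S1_X1C a N : S1 q a N *m X1 q a N = X1 q a N *m S1 q a N.
Proof. by rewrite S1E /X1; apply: diag_mxC. Qed.

Definition half_twist a N := S1 q a N *m S2 q a N *m S1 q a N.

(** The half-twist of the three strands exchanges [X1] and [X2], in two rotations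
    that pass through C13. *)
Lemma half_twist_X1 a N :
  X2 q a N *m half_twist a N = half_twist a N *m X1 q a N.
Proof.
rewrite /half_twist -[in RHS]mulmxA S1_X1C [in RHS]mulmxA.
rewrite -[S1 _ _ _ *m S2 _ _ _ *m X1 _ _ _]mulmxA S2_rotr.
by rewrite !mulmxA S1_rotr.
Qed.

Lemma half_twist_X2 a N :
  X1 q a N *m half_twist a N = half_twist a N *m X2 q a N.
Proof.
rewrite /half_twist -[in RHS]mulmxA S1_rotl !mulmxA.
rewrite -[S1 _ _ _ *m S2 _ _ _ *m casimir13 _ _ _]mulmxA S2_rotl.
by rewrite mulmxA S1_X1C.
Qed.

(** * Uniqueness of the duality matrix *)

Lemma hessenberg_eigen0 (n : nat) (T : 'M[R]_n.+1) (x : 'cV[R]_n.+1) c :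
  (forall i j : 'I_n.+1, (i.+1 < j)%N -> T i j = 0) ->
  (forall i j : 'I_n.+1, j = i.+1 :> nat -> T i j != 0) ->
  T *m x = c *: x -> x 0 0 = 0 -> x = 0.
Proof.
move=> T0 T1 Tx x0.
suff h m (j : 'I_n.+1) : (j <= m)%N -> x j 0 = 0.
  by apply/colP => j; rewrite mxE (h j).
elim: m j => [|m IH] j.
  by rewrite leqn0 => /eqP j0; rewrite (_ : j = 0) //; apply: val_inj.
rewrite leq_eqVlt ltnS => /orP[/eqP jm|]; last exact: IH.
have mn : (m < n.+1)%N by rewrite (leq_trans _ (ltn_ord j)) // jm.
have /matrixP/(_ (Ordinal mn) 0) := Tx.
rewrite [RHS]mxE [x (Ordinal mn) 0]IH // mulr0 mxE (bigD1 j) //=.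
rewrite big1 => [/eqP|k kj].
  by rewrite addr0 mulf_eq0 (negPf (T1 _ _ _)) //= => /eqP.
have [km|km] := leqP k m; first by rewrite IH // mulr0.
rewrite T0 ?mul0r //= ltn_neqAle km andbT -jm.
by apply: contraNneq kj => /val_inj ->.
Qed.

(** The first row of [Q] is a left eigenvector of [X2] and the columns are right
    eigenvectors; an eigenvector of an irreducible tridiagonal matrix is zero as
    soon as its first entry is. *)
Lemma X_intertwiner_eq0 a N (Q : 'M[R]_N.+1) :
  X2 q a N *m Q = Q *m X1 q a N -> X1 q a N *m Q = Q *m X2 q a N ->
  Q 0 0 = 0 -> Q = 0.
Proof.
move=> h21 h12 Q0.
have up0 (i j : 'I_N.+1) : (i.+1 < j)%N -> X2 q a N i j = 0.
  by move=> ij; rewrite X2_tridiag // -val_eqE /=; lia.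
have lo0 (i j : 'I_N.+1) : (j.+1 < i)%N -> X2 q a N i j = 0.
  by move=> ij; rewrite X2_tridiag // -val_eqE /=; lia.
have row0 : (row 0 Q)^T = 0.
  apply: (@hessenberg_eigen0 N (X2 q a N)^T _ (chi q a)).
  - by move=> i j ij; rewrite mxE lo0.
  - move=> i j ij; rewrite mxE X2E ij eqxx (ltn_eqF (ltnSn i)).
    by rewrite (ltn_eqF (leqnSn i.+1)) !add0r alpha_prev_neq0 // -ltnS -ij.
  - rewrite -trmx_mul -row_mul -h12 -linearZ /=; congr (_^T).
    by apply/rowP => j; rewrite /X1 mul_diag_mx !mxE addn0.
  - by rewrite !mxE.
apply/matrixP => i j; rewrite mxE.
have : col j Q = 0.
  apply: (@hessenberg_eigen0 _ (X2 q a N) _ (chi q (a + j))) => //.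
  - move=> i' j' ij; rewrite X2E ij eqxx (gtn_eqF (ltnSn i')).
    by rewrite (ltn_eqF (leqnSn i'.+1)) !addr0 alpha_next_neq0 // -ltnS -ij.
  - rewrite [in LHS]colE mulmxA -colE h21.
    by apply/colP => k; rewrite /X1 mul_mx_diag !mxE mulrC.
  - by have /colP/(_ j) := row0; rewrite !mxE.
by move/colP/(_ i); rewrite !mxE.
Qed.

Lemma X_intertwiner_scale a N (Q : 'M[R]_N.+1) :
  X2 q a N *m Q = Q *m X1 q a N -> X1 q a N *m Q = Q *m X2 q a N ->
  Q = Q 0 0 *: P_mx q a N.
Proof.
move=> h21 h12; apply/eqP; rewrite -subr_eq0; apply/eqP.
apply: (X_intertwiner_eq0 a).
- by rewrite mulmxBl mulmxBr -scalemxAl -scalemxAr h21 X2_P_mx.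
- by rewrite mulmxBl mulmxBr -scalemxAl -scalemxAr h12 X1_P_mx.
- by rewrite mxE [X in _ + X]mxE [X in - X]mxE P_mx_col0 mulr1 subrr.
Qed.

(** * The scalar *)

(** Leading coefficient of the polynomial that interpolates [gamma b] at the
    nodes [chi b, ..., chi (b + n)]. *)
Definition interp_lead b n : R :=
  (-1) ^+ n * q ^+ (n * (n + 2 * b + 2)) /
  (qfact (q ^+ 2) n * qfact (q ^+ (2 * (b + 1))) n).

(** The recursion of divided differences, in which the shift of the first node
    contributes the factor found in [gamma_node_shift]. *)
Lemma interp_leadS b n :
  (chi q (b + n.+1) - chi q b)^-1 *
    (- q ^+ (2 * (b + 1)) * interp_lead b.+1 n - interp_lead b n) =
  interp_lead b n.+1.
Proof.
rewrite /interp_lead !qfactS.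
have A0 : qfact (q ^+ 2) n != 0 by apply: qfact_neq0.
have B0 : qfact (q ^+ (2 * (b + 1))) n != 0 by apply: qfact_neq0; lia.
have d1 : 1 - q ^+ (2 * (b + 1)) != 0 by apply: subr1_exp_neq0; lia.
have -> : qfact (q ^+ (2 * (b.+1 + 1))) n =
    qfact (q ^+ (2 * (b + 1))) n * (1 - q ^+ (2 * (b + 1)) * q ^+ (2 * n)) /
    (1 - q ^+ (2 * (b + 1))).
  rewrite -qfactS qfact_shift mulrC mulKf // -exprD.
  by congr (qfact (_ ^+ _) _); lia.
have -> : (n * (n + 2 * b.+1 + 2) = n * (n + 2 * b + 2) + 2 * n)%N by lia.
have -> : (n.+1 * (n.+1 + 2 * b + 2) =
    n * (n + 2 * b + 2) + (2 * n + 2 * b + 3))%N.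
  by lia.
rewrite exprD [q ^+ (n * _ + _)]exprD (exprS (-1)).
have -> : chi q (b + n.+1) - chi q b =
    (q ^+ (2 * n + 2) - 1) * (q ^+ (4 * b + 2 * n + 4) - 1) /
    q ^+ (2 * b + 2 * n + 3).
  by rewrite /chi !q_monomE (exprS q n); field; rewrite ?(q0, expf_neq0).
move: (qfact _ n) (qfact _ n) A0 B0 (q ^+ (n * _)) ((-1) ^+ n).
move=> A B A0 B0 E s; move: d1; rewrite !q_monomE => d1. field.
rewrite ?(q0, expf_neq0) //= ?A0 ?B0 /=.
apply/and5P; split; last monom_neq0 (2 * n + 2)%N.
- monom_neq0 (2 * b + 2 * n + 2)%N.
- monom_neq0 (2 * n + 2)%N.
- monom_neq0 (2 * b + 2)%N.
- monom_neq0 (4 * b + 2 * n + 4)%N.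
Qed.

(** Neville's recursion for this polynomial, evaluated at a matrix. *)
Fixpoint neville {N} (X : 'M[R]_N.+1) n b : 'M[R]_N.+1 :=
  if n is n'.+1 then
    (chi q (b + n) - chi q b)^-1 *:
      (- q ^+ (2 * (b + 1)) *: ((X - (chi q b)%:M) *m neville X n' b.+1)
       - (X - (chi q (b + n))%:M) *m neville X n' b)
  else 1%:M.

Lemma neville_intertwine N (A B P : 'M[R]_N.+1) n b :
  A *m P = P *m B -> neville A n b *m P = P *m neville B n b.
Proof.
move=> h; elim: n b => [|n IH] b /=; first by rewrite mul1mx mulmx1.
rewrite -scalemxAl -scalemxAr mulmxBl mulmxBr -scalemxAl -scalemxAr.
by rewrite -!mulmxA !IH !mulmxA !(intertwineB _ _ _ _ h).
Qed.

(** Moving the first node turns [gamma] into another member of the same family,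
    which is what makes the divided differences have a closed form. *)
Lemma gamma_node_shift b r :
  gamma q b r.+1 = - q ^+ (2 * (b + 1)) * gamma q b.+1 r.
Proof.
rewrite /gamma (_ : (r.+1 * (r.+1 + 2 * b + 1))%N =
   (2 * (b + 1) + r * (r + 2 * b.+1 + 1))%N); last by lia.
by rewrite exprD exprS; ring.
Qed.

Lemma neville_eigen N (X : 'M[R]_N.+1) (v : 'cV[R]_N.+1) n b r :
  (r <= n)%N -> X *m v = chi q (b + r) *: v ->
  neville X n b *m v = gamma q b r *: v.
Proof.
elim: n b r => [|n IH] b r /= hr hv.
  by move: hr; rewrite leqn0 => /eqP ->; rewrite gamma0 mul1mx scale1r.
have comm c m d : (X - c%:M) *m neville X m d *m v =
    (chi q (b + r) - c) *: (neville X m d *m v).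
  rewrite -(neville_intertwine _ X X) ?(intertwineB X X X) //.
  by rewrite -mulmxA mulmxBl hv mul_scalar_mx -scalerBl -scalemxAr.
rewrite -scalemxAl mulmxBl -scalemxAl !comm.
have d0 : chi q (b + n.+1) - chi q b != 0.
  by apply: chiB_neq0; rewrite -{2}[b]addn0 eqn_add2l.
have low : (r <= n)%N -> neville X n b *m v = gamma q b r *: v.
  by move=> h; apply: IH.
have high r' : r = r'.+1 ->
    - q ^+ (2 * (b + 1)) *: (neville X n b.+1 *m v) = gamma q b r *: v.
  move=> er; rewrite er gamma_node_shift -scalerA (IH _ r') //.
    by rewrite -ltnS -er.
  by rewrite hv er addnS addSn.
rewrite scalerA mulrC -scalerA.
case: r hr hv comm low high => [|r] hr hv comm low high.
  rewrite addn0 subrr scale0r sub0r low // -scaleNr !scalerA; congr (_ *: _).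
  by field.
rewrite (high r) //; have [rn|rn] := leqP r.+1 n.
  by rewrite low // !scalerA -scalerBl scalerA; congr (_ *: _); field.
have -> : r.+1 = n.+1 by lia.
by rewrite subrr scale0r subr0 !scalerA; congr (_ *: _); field.
Qed.

(** Both sides are the polynomial interpolating [gamma] at the eigenvalues,
    evaluated at [X2]; it suffices to compare them at the diagonal matrix
    [X1]. *)
Lemma S2_neville a N : S2 q a N = neville (X2 q a N) N a.
Proof.
apply: (can_inj (mulmxK (P_mx_unit a N))); rewrite S2_P_mx.
rewrite (neville_intertwine _ _ _ _ _ _ (X2_P_mx a N)); congr (_ *m _).
apply: mx_delta_eq => j; rewrite (neville_eigen _ _ _ _ _ j) ?X1_delta ?leq_ord //.
rewrite S1E; apply/colP => i; rewrite mul_diag_mx !mxE.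
by case: eqP => [->|]; rewrite ?mulr0.
Qed.

(** A product of [n] affine functions of the tridiagonal matrix [X2] moves the
    first basis vector at most [n] steps down, and exactly [n] steps only
    through the subdiagonal entries; this adds one factor to the product. *)
Lemma X2_lower_step a N (Y : 'M[R]_N.+1) n c d :
  (forall i : 'I_N.+1, (n <= i)%N -> Y i 0 = c *+ (i == n :> nat)) ->
  forall i : 'I_N.+1, (n < i)%N ->
  ((X2 q a N - d%:M) *m Y) i 0 =
    alpha_prev q a N n.+1 * c *+ (i == n.+1 :> nat).
Proof.
move=> hY i ni; rewrite mulmxBl mul_scalar_mx mxE [X in _ + X]mxE [X in - X]mxE.
rewrite [Y i 0]hY 1?ltnW // (gtn_eqF ni) mulr0n mulr0 subr0 mxE.
have nN : (n < N.+1)%N by rewrite (ltn_trans ni).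
rewrite (bigD1 (Ordinal nN)) //= big1 => [|k kn].
  rewrite addr0 hY //= eqxx mulr1n X2E /= (ltn_eqF ni) (ltn_eqF (leqW ni)) !add0r.
  by case: eqP => [->|] //; rewrite mul0r.
have [nk|kn'] := ltnP n k; first by rewrite hY ?(gtn_eqF nk) ?mulr0 // ltnW.
rewrite X2_tridiag ?mul0r //; move: kn; rewrite -!val_eqE /=; lia.
Qed.

Lemma neville_lower a N n b (i : 'I_N.+1) : (n <= i)%N ->
  neville (X2 q a N) n b i 0 =
  interp_lead b n * \prod_(j < n) alpha_prev q a N j.+1 *+ (i == n :> nat).
Proof.
elim: n b i => [|n IH] b i ni.
  rewrite /= big_ord0 mulr1 /interp_lead /qfact !qpoch0 mul0n !expr0 !mulr1 divr1.
  by rewrite mxE -val_eqE.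
have := X2_lower_step a N _ n _ (chi q b) (IH b.+1) i ni.
have := X2_lower_step a N _ n _ (chi q (b + n.+1)) (IH b) i ni.
rewrite /=; move: (_ *m neville _ n b) (_ *m neville _ n b.+1) => Y2 Y1 e2 e1.
rewrite !mxE e1 e2.
case: (i == _ :> nat); rewrite ?mulr0n ?mulr0 ?subr0 ?mulr0 // !mulr1n.
rewrite -interp_leadS big_ord_recr /=; ring.
Qed.

(** Rewrites the denominators of the subdiagonal entries, which advance by steps of
    two, in terms of consecutive factors. *)
Lemma prod_even_odd (F : nat -> R) n :
  \prod_(i < n) (F (2 * i)%N * F (2 * i + 1)%N) =
  (\prod_(i < n) F i) * \prod_(i < n) F (n + i)%N.
Proof.
have -> : (\prod_(i < n) F i) * \prod_(i < n) F (n + i)%N =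
    \prod_(i < n + n) F i.
  by rewrite big_split_ord.
elim: n => [|n IH]; first by rewrite !big_ord0.
rewrite big_ord_recr /= IH (_ : (n.+1 + n.+1 = (n + n).+2)%N); last by lia.
rewrite !big_ord_recr /= -!mulrA.
by congr (_ * (F _ * F _)); lia.
Qed.

Lemma m_coefE a N :
  gamma q a N * (interp_lead a N * \prod_(j < N) alpha_prev q a N j.+1) =
  m_coef q a N.
Proof.
pose F m := 1 - q ^+ (4 * a + 4 + 2 * m).
have F0 m : F m != 0 by apply: subr1_exp_neq0; lia.
have -> : \prod_(j < N) alpha_prev q a N j.+1 =
    \prod_(j < N) (q ^+ (2 * a + 1) * (1 - q ^+ (2 * (a + 1)) * (q ^+ 2) ^+ j) *
      (1 - q ^+ 2 * (q ^+ 2) ^+ j) * F (N + j)%N *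
      (1 - q ^ (- 2 * (a%:Z + N%:Z)) * (q ^+ 2) ^+ j) *
      (F (2 * j)%N * F (2 * j + 1)%N)^-1).
  apply: eq_bigr => j _; rewrite /alpha_prev /alpha_down /=.
  congr (_ * _^-1).
    by rewrite /F !exprnAC2 !q_monomE (exprS q j); field; rewrite ?(q0, expf_neq0).
  by rewrite /F !q_monomE (exprS q j); congr (_ * _); ring.
rewrite !big_split /= prodfV prod_even_odd prodr_const card_ord.
rewrite /m_coef /interp_lead /qfact /qpoch !big_cons !big_nil !mulr1.
have -> : \prod_(i < N) (1 - q ^ (4 * (a%:Z + 1)) * (q ^+ 2) ^+ i) =
    \prod_(i < N) F i.
  by apply: eq_bigr => i _; rewrite /F exprnAC2 !q_monomE; ring.
have -> : q ^ (2 * N%:Z * (3 * a%:Z + N%:Z + 2)) =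
    q ^+ (N * (N + 2 * a + 1)) * q ^+ (N * (N + 2 * a + 2)) *
    q ^+ (2 * a + 1) ^+ N.
  by rewrite -exprM -!exprD -exprz_Posz; congr (_ ^ _); lia.
have pochS_neq0 m : \prod_(i < N) (1 - q ^+ m.+1 * (q ^+ 2) ^+ i) != 0.
  by apply/prodf_neq0 => i _; rewrite -exprM -exprD subr1_exp_neq0.
have V0 := pochS_neq0 1%N; have := pochS_neq0 (2 * a + 1)%N.
rewrite (_ : (2 * a + 1).+1 = 2 * (a + 1))%N; last by lia.
have f0 : \prod_(i < N) F i != 0 by apply/prodf_neq0 => i _.
have W0 : \prod_(i < N) F (N + i)%N != 0 by apply/prodf_neq0 => i _.
rewrite /gamma; move: (\prod_(i < N) F i) (\prod_(i < N) F (N + i)%N) f0 W0.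
move: (\prod_(i < N) _) (\prod_(i < N) _) (\prod_(i < N) _) V0.
move=> Z U V V0 f W f0 W0 U0.
have s2 : (-1) ^+ N * (-1) ^+ N = 1 :> R by rewrite -expr2 sqrr_sign.
move: (q ^+ _) (q ^+ _) (q ^+ _ ^+ N) ((-1) ^+ N) s2 => x y z s s2.
transitivity (s * s * (y * x * z * Z / f)); last by rewrite s2 mul1r.
by field; rewrite U0 V0 f0 W0.
Qed.

(** The entry [(N, 0)] of the half-twist involves only the leading coefficient
    of the interpolation polynomial, and the first column of [P_mx] is
    constant. *)
Lemma half_twistE a N : half_twist a N = m_coef q a N *: P_mx q a N.
Proof.
have e := X_intertwiner_scale a N _ (half_twist_X1 a N) (half_twist_X2 a N).
rewrite e; congr (_ *: _); rewrite -m_coefE.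
have /matrixP/(_ ord_max 0) := e.
rewrite [RHS]mxE P_mx_col0 mulr1 => <-.
rewrite /half_twist S1E mul_mx_diag mul_diag_mx !mxE gamma0 mulr1 S2_neville.
by rewrite neville_lower //= eqxx mulr1n.
Qed.

Lemma S1_unit a N : S1 q a N \in unitmx.
Proof.
rewrite S1E unitmxE det_diag unitfE; apply/prodf_neq0 => i _.
by rewrite mxE gamma_neq0.
Qed.

Lemma S2_unit a N : S2 q a N \in unitmx.
Proof.
have := P_mx_unit a N; have : S2 q a N *m P_mx q a N \in unitmx.
  by rewrite S2_P_mx unitmx_mul P_mx_unit S1_unit.
by rewrite unitmx_mul => /andP[].
Qed.

(** * Replacing q by its inverse *)

Lemma chi_inv j : chi q^-1 j = chi q j.
Proof. by rewrite /chi !exprz_inv addrC; congr (_ ^ _ + _ ^ _); lia. Qed.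

Lemma subr1_expzN x : 1 - q^-1 ^ x = - q ^ (- x) * (1 - q ^ x).
Proof.
rewrite exprz_inv exprzN; have : q ^ x != 0 by rewrite expfz_neq0.
by move: (q ^ x) => y y0; field.
Qed.

Lemma alpha_up_inv a N j : alpha_up q^-1 a N j.+1 = alpha_up q a N j.+1.
Proof.
rewrite /alpha_up !subr1_expzN exprz_inv.
have : 1 - q ^ (2 * (2 * j.+1%:Z + 2 * a%:Z - 1)) != 0.
  by rewrite subr1_expz_neq0 //; lia.
have : 1 - q ^ (2 * (2 * j.+1%:Z + 2 * a%:Z)) != 0.
  by rewrite subr1_expz_neq0 //; lia.
move: (1 - q ^ _) (1 - q ^ _) (1 - q ^ _) (1 - q ^ _) (1 - q ^ _) (1 - q ^ _).
move=> A B C D E F.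
rewrite !q_monomE => E0 F0.
by field; rewrite E0 F0 q0 !expf_neq0.
Qed.

Lemma alpha_down_inv a N j : alpha_down q^-1 a N j.+1 = alpha_down q a N j.+1.
Proof.
rewrite /alpha_down !subr1_expzN exprz_inv.
have : 1 - q ^ (2 * (2 * j.+1%:Z + 2 * a%:Z + 1)) != 0.
  by rewrite subr1_expz_neq0 //; lia.
have : 1 - q ^ (2 * (2 * j.+1%:Z + 2 * a%:Z)) != 0.
  by rewrite subr1_expz_neq0 //; lia.
move: (1 - q ^ _) (1 - q ^ _) (1 - q ^ _) (1 - q ^ _) (1 - q ^ _) (1 - q ^ _).
move=> A B C D E F.
rewrite !q_monomE => E0 F0.
by field; rewrite E0 F0 q0 !expf_neq0.
Qed.

Lemma X1_inv a N : X1 q^-1 a N = X1 q a N.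
Proof. by congr diag_mx; apply/rowP => i; rewrite !mxE chi_inv. Qed.

Lemma X2_inv a N : X2 q^-1 a N = X2 q a N.
Proof.
have next_inv i : alpha_next q^-1 a N i = alpha_next q a N i.
  by rewrite /alpha_next alpha_up_inv.
have prev_inv i : alpha_prev q^-1 a N i = alpha_prev q a N i.
  by case: i => // i; rewrite /alpha_prev alpha_down_inv.
by apply/matrixP => i j; rewrite !mxE !next_inv !prev_inv chi_inv.
Qed.

Lemma gamma_inv a r : gamma q^-1 a r * gamma q a r = 1.
Proof.
rewrite /gamma mulrACA -expr2 sqrr_sign mul1r exprVn mulVf //.
by rewrite expf_neq0.
Qed.

End GenericBase.

Arguments half_twist {R} q a N.

(** Replacing [q] by its inverse changes neither [X1] nor [X2], hence not the
    matrix [P_mx] that they determine. *)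
Lemma P_mx_inv (R : realFieldType) (q : R) a N : q != 0 ->
  (forall n, (0 < n)%N -> q ^+ n != 1) -> P_mx q^-1 a N = P_mx q a N.
Proof.
move=> q0 qn1; have Vq0 : q^-1 != 0 by rewrite invr_eq0.
have Vqn1 n : (0 < n)%N -> q^-1 ^+ n != 1.
  by move=> n0; rewrite exprVn invr_eq1 qn1.
rewrite (X_intertwiner_scale _ _ q0 qn1 a N (P_mx q^-1 a N)).
- by rewrite P_mx_col0 // scale1r.
- by have := X2_P_mx _ _ Vq0 Vqn1 a N; rewrite X1_inv // X2_inv.
- by have := X1_P_mx _ _ Vq0 Vqn1 a N; rewrite X1_inv // X2_inv.
Qed.

(** Inverting [q] inverts [gamma], hence [S1] and [S2]. *)
Lemma half_twist_inv (R : realFieldType) (q : R) a N : q != 0 ->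
  (forall n, (0 < n)%N -> q ^+ n != 1) ->
  half_twist q^-1 a N *m half_twist q a N = 1%:M.
Proof.
move=> q0 qn1; have Vq0 : q^-1 != 0 by rewrite invr_eq0.
have Vqn1 n : (0 < n)%N -> q^-1 ^+ n != 1.
  by move=> n0; rewrite exprVn invr_eq1 qn1.
have S1V : S1 q^-1 a N *m S1 q a N = 1%:M.
  rewrite !S1E // -diag_const_mx mul_diag_mx; apply/matrixP => i j.
  by rewrite !mxE mulrnAr gamma_inv.
have S2V : S2 q^-1 a N *m S2 q a N = 1%:M.
  apply: (can_inj (mulmxK (P_mx_unit _ _ q0 qn1 a N))).
  rewrite -mulmxA S2_P_mx // mulmxA -[in X in X *m _]P_mx_inv // S2_P_mx //.
  by rewrite -mulmxA S1V P_mx_inv // mulmx1 mul1mx.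
rewrite /half_twist !mulmxA -[_ *m S1 q^-1 a N *m S1 q a N]mulmxA S1V mulmx1.
by rewrite -[_ *m S2 q^-1 a N *m S2 q a N]mulmxA S2V mulmx1 S1V.
Qed.

Theorem theorem3p1 (R : realFieldType) (q : R) (s l : rat) (a N : nat)
    (hq0 : 0 < q) (hq1 : q < 1) (hs : is_spin s) (hl : in_J s l)
    (ha : a%:R = `|s - l|)
    (hN : N%:R = Num.min (2 * s) (s + l) - `|s - l|) :
  [/\ S1 q a N \in unitmx,
      S2 q a N \in unitmx,
      S1 q a N *m S2 q a N *m S1 q a N = m_coef q a N *: P_mx q a N &
      invmx (S1 q a N *m S2 q a N *m S1 q a N) = m_coef q^-1 a N *: P_mx q a N].
Proof.
have q0 : q != 0 by rewrite gt_eqF.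
have qn1 n : (0 < n)%N -> q ^+ n != 1.
  by move=> n0; rewrite lt_eqF // exprn_ilt1 ?ltW // -lt0n.
have Vq0 : q^-1 != 0 by rewrite invr_eq0.
have Vqn1 n : (0 < n)%N -> q^-1 ^+ n != 1.
  by move=> n0; rewrite exprVn invr_eq1 qn1.
split; [exact: S1_unit | exact: S2_unit | exact: half_twistE | ].
rewrite -/(half_twist q a N) -(P_mx_inv _ _ a N q0 qn1) -half_twistE //.
have tw : half_twist q^-1 a N *m half_twist q a N = 1%:M.
  exact: half_twist_inv.
have [_ tw_unit] := mulmx1_unit tw.
by rewrite -[LHS]mul1mx -tw mulmxK.
Qed.
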